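(* Let $(\mathcal A,<_A)$ and $(\mathcal B,<_B)$ be two ordered graphs and $k\in\mathbb N$. Then $(\mathcal A,<_A)$ and $(\mathcal B,<_B)$ satisfy exactly the same $\mathsf{CFO}$ sentences of quantifier rank at most $k$ if and only if Duplicator has a winning strategy in the $k$-round cluster Ehrenfeucht–Fraïssé game between $(\mathcal A,<_A)$ and $(\mathcal B,<_B)$.
   Context: Ordered graphs are structures over $\sigma\cup\{<\}$, $\sigma=\{E,P_1,\dots,P_N\}$, $E$ symmetric loopless binary, $P_\ell$ unary, $<$ a linear order. $\mathsf{CFO}$: fix an infinite alphabet $\Sigma$; variables $x_w^i$ ($w\in\Sigma^*$, $i\in\mathbb N$). For finite $S\subseteq\Sigma^*\times\mathbb N$, $X_S=\{x_w^i:(w,i)\in S\}$; $S$ is valid if $(w,i)\in S\Rightarrow(w,j)\in S$ for $j<i$ and $(w\alpha,0)\in S\Rightarrow(w,0)\in S$. $\mathsf{CFO}_S[0]$: Boolean combinations of $P_\ell(x_w^i)$, $E(x_w^i,x_w^j)$, $x_w^i\sim x_w^j$, $x_{w\alpha}^0\sim x_w^i$ (variables in $X_S$, $\sim\in\{=,<,>\}$). $\mathsf{CFO}_S[k+1]$: Boolean combinations of $\mathsf{CFO}_S[0]$ formulas and of $\exists x_\epsilon^0\psi$ ($S=\emptyset$, $\psi\in\mathsf{CFO}_{\{(\epsilon,0)\}}[k]$), $\exists x^0_{w\alpha}\psi$ ($(w,0)\in S$, $(w\alpha,0)\notin S$, $\psi\in\mathsf{CFO}_{S\cup\{(w\alpha,0)\}}[k]$),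 $\exists x_w^i(E(x_w^i,x_w^j)\wedge\psi)$ ($(w,j)\in S$, $i$ least with $(w,i)\notin S$, $\psi\in\mathsf{CFO}_{S\cup\{(w,i)\}}[k]$). The $\mathsf{CFO}$ sentences of quantifier rank $\le k$ are $\mathsf{CFO}_\emptyset[k]$. Cluster EF game: a configuration consists of a valid $S$ and pebble positions $p_w^i\in A$, $q_w^i\in B$ for $(w,i)\in S$. Starting from $S=\emptyset$, in each round Spoiler chooses one of the two structures (say $\mathcal A$; the other case is symmetric) and either (i) if $S=\emptyset$, places $p_\epsilon^0$ anywhere in $A$; (ii) if $S\ne\emptyset$, picks $w,\alpha$ with $(w,0)\in S$, $(w\alpha,0)\notin S$ and places $p_{w\alpha}^0$ anywhere in $A$; or (iii) picks $w$ with $(w,0)\in S$, lets $i$ be least with $(w,i)\notin S$, and places $p_w^i$ on an element adjacent to some $p_w^j$ with $j<i$. Duplicator answers by placing the corresponding pebble $q$ in the other structure; in case (iii) $q_w^i$ must be adjacent to $q_w^j$ (if impossible, Duplicator loses). The new pair is added to $S$. A configuration is winning for Duplicator if: for every $w$ with $(w,0)\in S$, the map $p_w^i\mapsto q_w^i$ ($(w,i)\in S$) is a partial isomorphism with respect to $E$, all $P_\ell$, $=$ and $<$; and for every $w,\alpha$ with $(w\alpha,0)\in S$, the map sending $p_w^i\mapsto q_w^i$ ($(w,i)\in S$) and $p_{w\alpha}^0\mapsto q_{w\alpha}^0$ is a partial isomorphism for the vocabulary $\{<\}$ (with equality). Duplicator wins the $k$-round game if she can ensure the configuration after $k$ rounds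 is winning, whatever Spoiler does. *)

(* Defs.v *)
From mathcomp Require Import all_boot all_order finmap.

Set Implicit Arguments.
Unset Strict Implicit.
Unset Printing Implicit Defensive.

Local Open Scope fset_scope.
Local Open Scope fmap_scope.

(* Ordered graphs over {E, P_1, ..., P_N, <}.  The vertex set may be infinite,
   and it may be empty. *)
Record ordGraph (N : nat) (d : Order.disp_t) := OrdGraph {
  vertex :> orderType d;
  edge : rel vertex;
  label : 'I_N -> pred vertex;
  edge_sym : symmetric edge;
  edge_irr : irreflexive edge }.

(* The pair (w, i) stands for the variable x_w^i, and for the pebbles p_w^i and
   q_w^i; the word w alpha is [rcons w alpha]. *)
Definition var (Sigma : choiceType) : choiceType := (seq Sigma * nat)%type.

Section Validity.
Variable Sigma : choiceType.
Implicit Types (S : {fset var Sigma}) (w : seq Sigma) (i : nat).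

Definition valid S : Prop :=
  (forall w i j, (w, i) \in S -> j < i -> (w, j) \in S) /\
  (forall w alpha, (rcons w alpha, 0) \in S -> (w, 0) \in S).

Definition least_new S w i : Prop :=
  (w, i) \notin S /\ forall j, j < i -> (w, j) \in S.

(* The next four facts show that validity is an invariant of the formation
   rules of CFO and of the rules of the game below, so that it does not have to
   be imposed there. *)
Lemma valid0 : valid fset0.
Proof. by split=> [w i j|w a]; rewrite in_fset0. Qed.

Lemma valid_root : valid [fset (([::], 0) : var Sigma)].
Proof.
split=> [w i j|w a]; rewrite !in_fset1.
  by move=> /eqP[-> ->].
by move=> /eqP[]; case: w.
Qed.

Lemma valid_child S w alpha :
  valid S -> (w, 0) \in S -> valid ((rcons w alpha, 0) |` S).
Proof.
move=> [H1 H2] Hw; split=> [u i j|u b]; rewrite !in_fset1U.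
  case/orP=> [/eqP[_ ->] //|Hi] lt_ji.
  by rewrite (H1 _ _ _ Hi lt_ji) orbT.
case/orP=> [/eqP[/rcons_inj[-> _]]|/H2 ->]; last by rewrite orbT.
by rewrite Hw orbT.
Qed.

Lemma valid_next S w i :
  valid S -> (w, 0) \in S -> least_new S w i -> valid ((w, i) |` S).
Proof.
move=> [H1 H2] Hw [Hnew Hi]; split=> [u k j|u b]; rewrite !in_fset1U.
  case/orP=> [/eqP[-> ->] /Hi ->|Hk lt_jk]; first by rewrite orbT.
  by rewrite (H1 _ _ _ Hk lt_jk) orbT.
case/orP=> [/eqP[Eu Ei]|/H2 ->]; last by rewrite orbT.
by move: Hnew; rewrite -Ei Hw.
Qed.

End Validity.

Section Logic.
Variables (Sigma : choiceType) (N : nat).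

(* First-order formulas over the variables x_w^i. *)
Inductive formula : Type :=
| Tru
| Lab (l : 'I_N) (x : var Sigma)
| Edge (x y : var Sigma)
| Cmp (c : comparison) (x y : var Sigma)
| Neg (phi : formula)
| And (phi psi : formula)
| Or (phi psi : formula)
| Ex (x : var Sigma) (phi : formula).

(* [CFO k S phi] is membership of phi in CFO_S[k]. *)
Inductive CFO : nat -> {fset var Sigma} -> formula -> Prop :=
| CFO_tru k S : CFO k S Tru
| CFO_lab k S l x : x \in S -> CFO k S (Lab l x)
| CFO_edge k S w i j :
    (w, i) \in S -> (w, j) \in S -> CFO k S (Edge (w, i) (w, j))
| CFO_cmp k S c w i j :
    (w, i) \in S -> (w, j) \in S -> CFO k S (Cmp c (w, i) (w, j))
| CFO_cmp_child k S c w alpha i :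
    (rcons w alpha, 0) \in S -> (w, i) \in S ->
    CFO k S (Cmp c (rcons w alpha, 0) (w, i))
| CFO_neg k S phi : CFO k S phi -> CFO k S (Neg phi)
| CFO_and k S phi psi : CFO k S phi -> CFO k S psi -> CFO k S (And phi psi)
| CFO_or k S phi psi : CFO k S phi -> CFO k S psi -> CFO k S (Or phi psi)
| CFO_ex_root k psi :
    CFO k [fset ([::], 0)] psi -> CFO k.+1 fset0 (Ex ([::], 0) psi)
| CFO_ex_child k S w alpha psi :
    (w, 0) \in S -> (rcons w alpha, 0) \notin S ->
    CFO k ((rcons w alpha, 0) |` S) psi ->
    CFO k.+1 S (Ex (rcons w alpha, 0) psi)
| CFO_ex_next k S w i j psi :
    (w, j) \in S -> least_new S w i ->
    CFO k ((w, i) |` S) psi ->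
    CFO k.+1 S (Ex (w, i) (And (Edge (w, i) (w, j)) psi)).

(* Assignments are finite maps; an atom with an unassigned variable is false,
   which never happens for formulas of CFO_S[k] under assignments with
   domain S. *)
Definition holds1 (T : Type) (P : pred T) (v : {fmap var Sigma -> T}) x : bool :=
  if v.[? x] is Some a then P a else false.

Definition holds2 (T : Type) (r : rel T) (v : {fmap var Sigma -> T}) x y : bool :=
  if v.[? x] is Some a then if v.[? y] is Some b then r a b else false
  else false.

Definition compare_rel d (T : orderType d) (c : comparison) : rel T :=
  match c with
  | Eq => fun a b => a == b
  | Lt => fun a b => (a < b)%O
  | Gt => fun a b => (a > b)%O
  end.

Fixpoint sat d (G : ordGraph N d) (v : {fmap var Sigma -> G}) (phi : formula)
    : Prop :=
  match phi with
  | Tru => True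
  | Lab l x => holds1 (@label N d G l) v x
  | Edge x y => holds2 (@edge N d G) v x y
  | Cmp c x y => holds2 (@compare_rel d G c) v x y
  | Neg phi => ~ sat v phi
  | And phi psi => sat v phi /\ sat v psi
  | Or phi psi => sat v phi \/ sat v psi
  | Ex x phi => exists a : G, sat v.[x <- a] phi
  end.

Definition models d (G : ordGraph N d) (phi : formula) : Prop :=
  sat ([fmap] : {fmap var Sigma -> G}) phi.

End Logic.

Definition same_CFO_sentences (Sigma : choiceType) (N : nat)
    (dA dB : Order.disp_t) (A : ordGraph N dA) (B : ordGraph N dB) (k : nat)
    : Prop :=
  forall phi : formula Sigma N, CFO k fset0 phi -> (models A phi <-> models B phi).

Section Game.
Variables (Sigma : choiceType) (N : nat) (dA dB : Order.disp_t).
Variables (A : ordGraph N dA) (B : ordGraph N dB).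

(* A configuration is the finite map sending each (w, i) in S to the pair
   (p_w^i, q_w^i); the set S is its domain. *)
Definition config : Type := {fmap var Sigma -> A * B}.

(* For a set R of pairs, to be thought of as the graph of a map: being a
   well-defined injective map is the equivalence between equalities. *)
Definition partial_iso_order (R : A -> B -> Prop) : Prop :=
  forall a b a' b', R a b -> R a' b' ->
    (a = a' <-> b = b') /\ ((a < a')%O <-> (b < b')%O).

Definition partial_iso (R : A -> B -> Prop) : Prop :=
  [/\ partial_iso_order R,
      forall a b a' b', R a b -> R a' b' -> (edge a a' <-> edge b b')
    & forall l a b, R a b -> (label l a <-> label l b)].

Definition cluster (c : config) (w : seq Sigma) (a : A) (b : B) : Prop :=
  exists i, c.[? (w, i)] = Some (a, b).

Definition winning (c : config) : Prop :=
  (forall w, (w, 0) \in domf c -> partial_iso (cluster c w)) /\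
  (forall w alpha, (rcons w alpha, 0) \in domf c ->
     partial_iso_order (fun a b =>
       cluster c w a b \/ c.[? (rcons w alpha, 0)] = Some (a, b))).

(* [move S x y]: when the pairs in S have been played, Spoiler may play the
   pair x of pebbles; [y = Some z] records that x has to be placed next to the
   earlier pebble z. *)
Inductive move (S : {fset var Sigma}) : var Sigma -> option (var Sigma) -> Prop :=
| move_root : S = fset0 -> move S ([::], 0) None
| move_child w alpha :
    (w, 0) \in S -> (rcons w alpha, 0) \notin S ->
    move S (rcons w alpha, 0) None
| move_next w i j :
    (w, 0) \in S -> least_new S w i -> j < i ->
    move S (w, i) (Some (w, j)).

Definition placeA (c : config) (y : option (var Sigma)) (a : A) : Prop :=
  if y is Some z then exists2 ab, c.[? z] = Some ab & edge a ab.1 else True.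

Definition placeB (c : config) (y : option (var Sigma)) (b : B) : Prop :=
  if y is Some z then exists2 ab, c.[? z] = Some ab & edge b ab.2 else True.

(* Duplicator can ensure a winning configuration after k more rounds. *)
Fixpoint wins_from (k : nat) (c : config) : Prop :=
  match k with
  | 0 => winning c
  | k'.+1 => forall x y, move (domf c) x y ->
      (forall a, placeA c y a ->
         exists2 b, placeB c y b & wins_from k' c.[x <- (a, b)]) /\
      (forall b, placeB c y b ->
         exists2 a, placeA c y a & wins_from k' c.[x <- (a, b)])
  end.

End Game.

Definition Duplicator_wins (Sigma : choiceType) (N : nat)
    (dA dB : Order.disp_t) (A : ordGraph N dA) (B : ordGraph N dB) (k : nat)
    : Prop :=
  wins_from k ([fmap] : config Sigma A B).

(* Main.v *)
(** A move of Spoiler corresponds to a quantifier formation rule of CFO, so a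
   winning strategy transfers CFO_S[k] formulas by induction on the formula.
   Conversely, for each k and S finitely many CFO_S[k] formulas suffice to force
   a win: if the formulas in a finite list L force a win after a move, then the
   quantifications of the complete Boolean types over L force it before the
   move.  Spoiler has infinitely many moves (w alpha, 0), but an automorphism of
   the tree of words exchanges any two unused letters below w, so that one
   representative letter per w is enough. *)
Require Import Defs.
From Stdlib Require List.
From mathcomp Require Import all_boot all_order finmap.
From mathcomp Require Import boolp classical_sets cardinality.

Section FreshLetters.
Set Implicit Arguments.
Unset Strict Implicit.
Variable Sigma : choiceType.
Implicit Types (S : {fset var Sigma}) (u w : seq Sigma) (x : var Sigma).
Local Open Scope fset_scope.

Lemma valid_word0 S x : valid S -> x \in S -> (x.1, 0) \in S.
Proof. by case: x => w [|i] [vS _] // /vS; apply. Qed.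

Lemma move_notin S x y : move S x y -> x \notin S.
Proof. by case=> [->|//|w i j _ []//]; rewrite in_fset0. Qed.

Lemma move_valid S x y : valid S -> move S x y -> valid (x |` S).
Proof.
move=> vS; case=> [->|w a|w i j wS wi _]; last exact: valid_next.
- by rewrite fsetU0; exact: valid_root.
- by move=> wS _; exact: valid_child.
Qed.

Lemma move_anchor S x z : move S x (Some z) -> z \in S.
Proof.
move E : (Some z) => y m; case: m E => // w i j _ [_ lt_i] ltji [->].
exact: lt_i.
Qed.

Lemma fresh_child S w : infinite_set [set: Sigma]%classic ->
  exists a, (rcons w a, 0) \notin S.
Proof.
move=> Sinf; apply: contrapT => /forallNP H; apply: Sinf; apply/finite_seqP.
(* [ohead (rev x.1)] is the last letter of a word. If every child of [w] were in [S], the last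
   letters of the words in [S] would exhaust [Sigma]. *)
exists (pmap (fun x => ohead (rev x.1)) S); apply/seteqP; split=> // a _ /=.
rewrite mem_pmap; apply/mapP; exists (rcons w a, 0); last by rewrite /= rev_rcons.
by have /negP := H a; rewrite negbK.
Qed.

(** The automorphism of the tree of words that exchanges the subtrees rooted at [rcons w a] and
    [rcons w b] and fixes all other words. *)
Fixpoint swap_child w (a b : Sigma) u : seq Sigma :=
  match w, u with
  | _, [::] => [::]
  | [::], e :: u' => (if e == a then b else if e == b then a else e) :: u'
  | d :: w', e :: u' => if d == e then e :: swap_child w' a b u' else u
  end.

Lemma swap_child_nil w a b : swap_child w a b [::] = [::].
Proof. by case: w. Qed.

Lemma swap_childK w a b : involutive (swap_child w a b).
Proof.
elim: w => [|d w IH] [|e u] //=.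
  have [->|nea] := eqVneq e a; first by have [->|] := eqVneq b a; rewrite ?eqxx.
  by have [->|neb] := eqVneq e b; rewrite ?eqxx ?(negPf nea) ?(negPf neb).
by case: (eqVneq d e) => [->|nde] /=; rewrite ?eqxx ?IH ?(negPf nde).
Qed.

(** Compatibility with the tree structure: it is what carries child moves of the game to child
    moves. *)
Lemma swap_child_rcons w a b u e :
  exists e', swap_child w a b (rcons u e) = rcons (swap_child w a b u) e'.
Proof.
elim: w u => [|d w IH] [|g u] /=.
- by eexists.
- by exists e.
- by exists e; case: eqP => // _; rewrite swap_child_nil.
- case: eqP => _; last by exists e.
  by have [e' ->] := IH u; exists e'.
Qed.

Lemma swap_child_self w a b : swap_child w a b (rcons w a) = rcons w b.
Proof. by elim: w => [|d w IH] /=; rewrite eqxx ?IH. Qed.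

Lemma swap_child_id w a b u :
  ~~ prefix (rcons w a) u -> ~~ prefix (rcons w b) u -> swap_child w a b u = u.
Proof.
elim: w u => [|d w IH] [|e u] //=.
  rewrite !prefix0s !andbT ![_ == e]eq_sym.
  by move=> /negPf-> /negPf->.
by case: eqVneq => //= <- ha hb; rewrite IH.
Qed.

Lemma valid_prefix S w a u i :
  valid S -> (u, i) \in S -> prefix (rcons w a) u -> (rcons w a, 0) \in S.
Proof.
move=> vS /(valid_word0 vS) /=; elim/last_ind: u => [|u e IH] uS.
  by rewrite prefixs0; case: w.
move=> /prefixP[t]; case/lastP: t => [|t e']; first by rewrite cats0 => <-.
rewrite -rcons_cat => /rcons_inj[uE _]; apply: IH.
  by case: vS => _ /(_ _ _ uS).
by rewrite uE prefix_prefix.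
Qed.

End FreshLetters.

(** * Configurations of the game: restriction and renaming of words *)

Section Configurations.
Set Implicit Arguments.
Unset Strict Implicit.
Variables (Sigma : choiceType) (N : nat) (dA dB : Order.disp_t).
Variables (A : ordGraph N dA) (B : ordGraph N dB).
Implicit Types (S : {fset var Sigma}) (x : var Sigma) (phi psi : formula Sigma N).
Implicit Types (c : config Sigma A B) (y : option (var Sigma)).
Implicit Types (vA : {fmap var Sigma -> A}) (vB : {fmap var Sigma -> B}).
Local Open Scope fset_scope.
Local Open Scope fmap_scope.

Lemma domf_fnd (T : Type) (f : {fmap var Sigma -> T}) x :
  x \in domf f -> exists t, f.[? x] = Some t.
Proof. by case: fndP => // p _; eexists. Qed.

Lemma fnd_domf (T : Type) (f : {fmap var Sigma -> T}) x t :
  f.[? x] = Some t -> x \in domf f.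
Proof. by case: fndP. Qed.

Lemma partial_iso_order_sub (R R' : A -> B -> Prop) :
  (forall a b, R a b -> R' a b) -> partial_iso_order R' -> partial_iso_order R.
Proof. by move=> RR' H a b a' b' r r'; apply: H; exact: RR'. Qed.

Lemma partial_iso_sub (R R' : A -> B -> Prop) :
  (forall a b, R a b -> R' a b) -> partial_iso R' -> partial_iso R.
Proof.
move=> RR' [H1 H2 H3]; split; first exact: partial_iso_order_sub H1.
  by move=> a b a' b' r r'; apply: H2; exact: RR'.
by move=> l a b /RR'; exact: H3.
Qed.

Lemma winning_sub c c' :
  (forall x ab, c.[? x] = Some ab -> c'.[? x] = Some ab) ->
  winning c' -> winning c.
Proof.
move=> sub.
have subd x : x \in domf c -> x \in domf c'.
  by move=> xc; have [ab /sub cx] := domf_fnd xc; exact: fnd_domf cx.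
move=> [H1 H2]; split=> [w /subd/H1|w a /subd/H2].
  by apply: partial_iso_sub => a b [i /sub]; exists i.
apply: partial_iso_order_sub => p q [[i /sub]|/sub]; last by right.
by left; exists i.
Qed.

(* The game only inspects the last configuration.  An infinite alphabet lets
   Spoiler always move, so intermediate configurations must be winning too. *)
Lemma wins_winning k c : infinite_set [set: Sigma]%classic ->
  valid (domf c) -> wins_from k c -> winning c.
Proof.
move=> Sinf; elim: k c => [//|k IH] c vc H.
have [c0|[[w i] /(valid_word0 vc) /= wc]] := fset_0Vmem (domf c).
  have notin x : x \in domf c -> False by rewrite c0 in_fset0.
  by split=> [w /notin|w a /notin].
have [a fa] := fresh_child (domf c) w Sinf.
have m : move (domf c) (rcons w a, 0) None by apply: move_child.
have [[p q] _] := domf_fnd wc.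
have [/(_ p I)[b _] /IH W _] := H _ _ m.
apply: winning_sub (W (move_valid vc m)) => x ab cx.
rewrite fnd_set; case: eqP => // xE; move: fa.
by rewrite -xE (fnd_domf cx).
Qed.

(** The rules of the game see only which words are equal, empty, or parent and child, and [f]
    respects all of this. Duplicator answers in [c'] as she would answer the translated move in
    [c]. *)
Lemma wins_rename k (f : seq Sigma -> seq Sigma) c c' :
  involutive f -> f [::] = [::] ->
  (forall u e, exists e', f (rcons u e) = rcons (f u) e') ->
  (forall x, c'.[? (f x.1, x.2)] = c.[? x]) ->
  wins_from k c -> wins_from k c'.
Proof.
move=> fK f0 fS.
pose F x : var Sigma := (f x.1, x.2).
have FK : involutive F by case=> u i; rewrite /F /= fK.
elim: k c c' => [|k IH] c c' cc'.
all: have cF x : c.[? F x] = c'.[? x] by rewrite -(cc' (F x)) -[in RHS](FK x).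
all: have dF x : (F x \in domf c) = (x \in domf c') by rewrite -!fndSome cF.
- move=> [H1 H2]; split=> [w wc|w a wc].
    apply: partial_iso_sub (H1 (f w) _); last by rewrite -(dF (w, 0)) in wc.
    by move=> a b [i]; rewrite -cF; exists i.
  have [a' fa] := fS w a.
  have wc' : (rcons (f w) a', 0) \in domf c by rewrite -fa (dF (_, _)).
  apply: partial_iso_order_sub (H2 _ _ wc') => p q [[i]|]; rewrite -cF.
    by left; exists i.
  by rewrite /F /= fa; right.
- move=> H x y m.
  have m' : move (domf c) (F x) (omap F y).
    case: m => [c0|w a wS aS|w i j wS [iS lti] ltji].
    + rewrite /F /= f0; apply: move_root; apply/fsetP=> x'.
      by rewrite -(FK x') dF c0 !in_fset0.
    + have [a' fa] := fS w a; rewrite /F /= fa; apply: move_child.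
        by rewrite (dF (w, 0)).
      by rewrite -fa (dF (rcons w a, 0)).
    + apply: move_next => //; first by rewrite (dF (w, 0)).
      split; first by rewrite (dF (w, i)).
      by move=> j' /lti; rewrite -dF.
  have pA a : placeA c (omap F y) a <-> placeA c' y a.
    by case: (y) => [z|] //=; rewrite cF.
  have pB b : placeB c (omap F y) b <-> placeB c' y b.
    by case: (y) => [z|] //=; rewrite cF.
  have ext ab : wins_from k c.[F x <- ab] -> wins_from k c'.[x <- ab].
    apply: IH => x'; rewrite !fnd_set -/(F x') cc'.
    by rewrite -(inj_eq (inv_inj FK)) FK.
  have [HA HB] := H _ _ m'; split.
    by move=> a /pA /HA[b /pB ? /ext ?]; exists b.
  by move=> b /pB /HB[a /pA ? /ext ?]; exists a.
Qed.

Lemma wins_other_child k c w e e' ab :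
  valid (domf c) -> (rcons w e, 0) \notin domf c ->
  (rcons w e', 0) \notin domf c ->
  wins_from k c.[(rcons w e, 0) <- ab] -> wins_from k c.[(rcons w e', 0) <- ab].
Proof.
move=> vc ec ec'.
have fE := swap_child_self w e e'.
apply: (wins_rename (swap_childK w e e') (swap_child_nil w e e')).
  exact: swap_child_rcons.
case=> u i /=; rewrite !fnd_set.
have -> : ((swap_child w e e' u, i) == (rcons w e', 0)) =
          ((u, i) == (rcons w e, 0)).
  by rewrite !xpair_eqE -fE (inj_eq (inv_inj (swap_childK w e e'))).
case: eqP => // ui.
have notin u' : (u', i) \in domf c -> swap_child w e e' u' = u'.
  move=> uc; apply: swap_child_id; apply/negP=> /(valid_prefix vc uc).
    by rewrite (negPf ec).
  by rewrite (negPf ec').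
case: (boolP ((u, i) \in domf c)) => uc; first by rewrite notin.
(* Were the swapped position occupied, the swap would fix it, and the original position would be
   occupied as well. *)
rewrite [RHS]not_fnd // not_fnd //; apply/negP => sc.
have := notin _ sc; rewrite swap_childK => E.
by move: sc; rewrite -E (negPf uc).
Qed.

(** * Assignments induced by a configuration, and quantifiers as moves *)

Definition projections c vA vB : Prop := forall x,
  vA.[? x] = omap fst c.[? x] /\ vB.[? x] = omap snd c.[? x].

Lemma projections_set c vA vB x a b : projections c vA vB ->
  projections c.[x <- (a, b)] vA.[x <- a] vB.[x <- b].
Proof. by move=> p z; rewrite !fnd_set; case: eqP => // _; exact: p. Qed.

Definition place (d : Order.disp_t) (G : ordGraph N d)
    (v : {fmap var Sigma -> G}) y (g : G) : Prop :=
  if y is Some z then exists2 h, v.[? z] = Some h & edge g h else True.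

Lemma placeAE c vA vB y a :
  projections c vA vB -> placeA c y a <-> place vA y a.
Proof.
move=> p; case: y => //= z; rewrite (p z).1.
case: c.[? z] => [ab|]; split=> -[] //= h [<-]; first by exists ab.1.
by exists ab.
Qed.

Lemma placeBE c vA vB y b :
  projections c vA vB -> placeB c y b <-> place vB y b.
Proof.
move=> p; case: y => //= z; rewrite (p z).2.
case: c.[? z] => [ab|]; split=> -[] //= h [<-]; first by exists ab.2.
by exists ab.
Qed.

(** The anchor [y] of a move selects the guard, so that the three quantifier rules of CFO become
    one. *)
Definition quant x y psi : formula Sigma N :=
  Ex x (if y is Some z then And (Edge N x z) psi else psi).

Lemma CFO_quant k S x y psi :
  move S x y -> CFO k (x |` S) psi -> CFO k.+1 S (quant x y psi).
Proof.
case=> [->|w a wS aS|w i j wS [iS lti] ltji] H.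
- by apply: CFO_ex_root; rewrite fsetU0 in H.
- exact: CFO_ex_child.
- by apply: CFO_ex_next => //; exact: lti.
Qed.

Lemma sat_quant (d : Order.disp_t) (G : ordGraph N d)
    (v : {fmap var Sigma -> G}) S x y psi : move S x y ->
  sat v (quant x y psi) <-> exists2 g, place v y g & sat v.[x <- g] psi.
Proof.
move=> m; case: y m => [z|] m /=; last first.
  by split=> [[g ?]|[g _ ?]]; exists g.
(* The anchor [z] has been played and [x] has not, so updating [x] leaves the value of [z]
   unchanged. *)
have zx : (z == x) = false.
  by apply: contraNF (move_notin m) => /eqP<-; exact: move_anchor m.
rewrite /holds2; split=> [[g]|[g [h vz gh] H]].
  rewrite !fnd_set eqxx zx; case: v.[? z] => [h|] [] // gh H.
  by exists g => //; exists h.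
by exists g; rewrite !fnd_set eqxx zx vz.
Qed.

(** * From a winning strategy to agreement on formulas *)

Definition agree phi vA vB : Prop := sat vA phi <-> sat vB phi.

Lemma holds2_projections c vA vB x z a b a' b' (r : rel A) (r' : rel B) :
  projections c vA vB -> c.[? x] = Some (a, b) -> c.[? z] = Some (a', b') ->
  (holds2 r vA x z <-> holds2 r' vB x z) <-> (r a a' <-> r' b b').
Proof.
move=> p cx cz; rewrite /holds2 (p x).1 (p x).2 (p z).1 (p z).2.
by rewrite cx cz.
Qed.

(** [R] is left open to cover both comparisons within a cluster and comparisons with the first
    pebble of a child cluster. *)
Lemma winning_agree_cmp (R : A -> B -> Prop) c vA vB x z r :
  projections c vA vB -> x \in domf c -> z \in domf c ->
  partial_iso_order R ->
  (forall a b, c.[? x] = Some (a, b) -> R a b) ->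
  (forall a b, c.[? z] = Some (a, b) -> R a b) ->
  agree (Cmp N r x z) vA vB.
Proof.
move=> p /domf_fnd[[a b] cx] /domf_fnd[[a' b'] cz] H /(_ _ _ cx) Rx.
move=> /(_ _ _ cz) Rz; apply/(holds2_projections _ _ p cx cz).
have [eqab ltab] := H _ _ _ _ Rx Rz; have [_ gtab] := H _ _ _ _ Rz Rx.
by case: r => //=; split=> /eqP/eqab/eqP.
Qed.

(** Duplicator's answer to a witness on one side is a witness on the other; the two halves of
    [wins_from] give the two implications. *)
Lemma wins_agree_quant k S x y psi : move S x y ->
  (forall c vA vB, domf c = x |` S -> valid (x |` S) -> projections c vA vB ->
    wins_from k c -> agree psi vA vB) ->
  forall c vA vB, domf c = S -> valid S -> projections c vA vB ->
    wins_from k.+1 c -> agree (quant x y psi) vA vB.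
Proof.
move=> m IH c vA vB dc vS p W; rewrite /agree !(sat_quant _ _ m).
rewrite -dc in m IH vS; have [WA WB] := W _ _ m.
have {}IH a b : wins_from k c.[x <- (a, b)] -> agree psi vA.[x <- a] vB.[x <- b].
  apply: IH (move_valid vS m) (projections_set x a b p).
  by rewrite dom_setf.
split=> -[g].
  by move=> /(placeAE _ _ p)/WA[h /(placeBE _ _ p) ph /IH H /H]; exists h.
by move=> /(placeBE _ _ p)/WB[h /(placeAE _ _ p) ph /IH H /H]; exists h.
Qed.

(** Induction on the derivation of [CFO k S phi]. Atoms may occur while rounds remain to be played,
    so they go through [wins_winning], which uses the infinite alphabet. *)
Lemma wins_agree k S phi c vA vB : infinite_set [set: Sigma]%classic ->
  CFO k S phi -> domf c = S -> valid S -> projections c vA vB ->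
  wins_from k c -> agree phi vA vB.
Proof.
move=> Sinf C; elim: C c vA vB => {k S phi}.
- by [].
- move=> k S l x xS c vA vB dc vc p W.
  move: vc; rewrite -dc => vc; rewrite -dc in xS.
  have [[a b] cx] := domf_fnd xS.
  have [/(_ _ (valid_word0 vc xS))[_ _ H] _] := wins_winning Sinf vc W.
  rewrite /agree /= /holds1 (p x).1 (p x).2 cx; apply: H.
  by exists x.2; rewrite -cx; case: (x).
- move=> k S w i j iS jS c vA vB dc vc p W.
  move: vc; rewrite -dc => vc; rewrite -dc in iS jS.
  have [[a b] ci] := domf_fnd iS; have [[a' b'] cj] := domf_fnd jS.
  have [/(_ _ (valid_word0 vc iS))[_ H _] _] := wins_winning Sinf vc W.
  apply/(holds2_projections _ _ p ci cj).
  by apply: H; [exists i|exists j].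
- move=> k S r w i j iS jS c vA vB dc vc p W.
  move: vc; rewrite -dc => vc; rewrite -dc in iS jS.
  have [/(_ _ (valid_word0 vc iS))[H _ _] _] := wins_winning Sinf vc W.
  by apply: (winning_agree_cmp _ p iS jS H) => a b ?; [exists i|exists j].
- move=> k S r w e i eS iS c vA vB dc vc p W.
  move: vc; rewrite -dc => vc; rewrite -dc in iS eS.
  have [_ /(_ _ _ eS) H] := wins_winning Sinf vc W.
  apply: (winning_agree_cmp _ p eS iS H) => a b ?; first by right.
  by left; exists i.
- move=> k S phi _ IH c vA vB dc vc p W.
  by have [? ?] := IH _ _ _ dc vc p W; rewrite /agree /=; tauto.
- move=> k S phi psi _ IH1 _ IH2 c vA vB dc vc p W.
  have [? ?] := IH1 _ _ _ dc vc p W; have [? ?] := IH2 _ _ _ dc vc p W.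
  by rewrite /agree /=; tauto.
- move=> k S phi psi _ IH1 _ IH2 c vA vB dc vc p W.
  have [? ?] := IH1 _ _ _ dc vc p W; have [? ?] := IH2 _ _ _ dc vc p W.
  by rewrite /agree /=; tauto.
- move=> k psi _ IH.
  apply: (wins_agree_quant (y := None) (move_root erefl)).
  by rewrite fsetU0.
- move=> k S w e psi wS eS _ IH.
  by apply: (wins_agree_quant (y := None)) IH; exact: move_child.
- move=> k S w i j psi jS [iS lti] _ IH c vA vB dc vS.
  apply: (wins_agree_quant (y := Some (w, j))) IH _ _ _ dc (vS).
  apply: move_next => //; first exact: (valid_word0 vS jS).
  (* The formation rule gives only [(w, j) \in S], while the move asks for [j < i]. If [i <= j],
     validity would put [(w, i)] in [S], although it is new. *)
  rewrite ltnNge; apply: contraNN iS; rewrite leq_eqVlt => /orP[/eqP->//|].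
  by case: vS => vS _ /vS; apply.
Qed.

(** * Properties forced by agreement on a finite list of formulas *)

Definition forced k S (P : {fmap var Sigma -> A} -> {fmap var Sigma -> B} -> Prop) :=
  exists2 L : seq (formula Sigma N), (forall phi, List.In phi L -> CFO k S phi) &
    forall vA vB, (forall phi, List.In phi L -> agree phi vA vB) -> P vA vB.

Lemma forced_impl k S (P Q : _ -> _ -> Prop) :
  (forall vA vB, P vA vB -> Q vA vB) -> forced k S P -> forced k S Q.
Proof. by move=> PQ [L LC LP]; exists L => // vA vB /LP/PQ. Qed.

Lemma forced_true k S (P : _ -> _ -> Prop) :
  (forall vA vB, P vA vB) -> forced k S P.
Proof. by exists [::]. Qed.

(** [C] does not involve the assignments, so it can be decided before the list is chosen. *)
Lemma forced_cond k S (C : Prop) (P : _ -> _ -> Prop) :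
  (C -> forced k S P) -> forced k S (fun vA vB => C -> P vA vB).
Proof.
by have [c /(_ c)|nc _] := EM C; [apply: forced_impl|apply: forced_true].
Qed.

Lemma forced_and k S (P Q : _ -> _ -> Prop) :
  forced k S P -> forced k S Q -> forced k S (fun vA vB => P vA vB /\ Q vA vB).
Proof.
move=> [L LC LP] [M MC MQ]; exists (L ++ M).
  by move=> phi /List.in_app_iff[/LC|/MC].
move=> vA vB H; split; [apply: LP|apply: MQ] => phi h; apply: H.
  by apply/List.in_app_iff; left.
by apply/List.in_app_iff; right.
Qed.

Lemma forced_all k S (T : eqType) (s : seq T) (P : T -> _ -> _ -> Prop) :
  (forall t, t \in s -> forced k S (P t)) ->
  forced k S (fun vA vB => forall t, t \in s -> P t vA vB).
Proof.
elim: s => [|t s IH] H; first exact: forced_true.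
have Ht : forced k S (P t) by apply: H; rewrite mem_head.
have Hs : forced k S (fun vA vB => forall t, t \in s -> P t vA vB).
  by apply: IH => t' t's; apply: H; rewrite in_cons t's orbT.
apply: forced_impl (forced_and Ht Hs) => vA vB [H1 H2] t'.
by rewrite in_cons => /orP[/eqP->|/H2].
Qed.

Lemma forced_agree k S phi : CFO k S phi -> forced k S (agree phi).
Proof.
move=> C; exists [:: phi] => [psi [<-|[]]//|vA vB]; apply; by left.
Qed.

(** Each conjunction takes every formula of [L] or its negation, so two assignments satisfying a
    common one agree on all of [L]. *)
Fixpoint complete_types (L : seq (formula Sigma N)) : seq (formula Sigma N) :=
  if L is phi :: L' then
    map (And phi) (complete_types L') ++ map (And (Neg phi)) (complete_types L')
  else [:: Tru Sigma N].

Lemma complete_types_CFO k S L : (forall phi, List.In phi L -> CFO k S phi) ->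
  forall t, List.In t (complete_types L) -> CFO k S t.
Proof.
elim: L => [|phi L IH] LC t /=; first by case=> [<-|[]]; exact: CFO_tru.
have Cphi : CFO k S phi by apply: LC; left.
have CL := IH (fun psi h => LC psi (or_intror h)).
case/List.in_app_iff => /List.in_map_iff[t' [<- /CL Ct]]; apply: CFO_and => //.
exact: CFO_neg.
Qed.

Lemma complete_types_ex (d : Order.disp_t) (G : ordGraph N d)
    (v : {fmap var Sigma -> G}) L :
  exists2 t, List.In t (complete_types L) & sat v t.
Proof.
elim: L => [|phi L [t tL vt]] /=; first by exists (Tru Sigma N) => //; left.
have [h|h] := EM (sat v phi).
  exists (And phi t) => //; apply/List.in_app_iff; left.
  exact: List.in_map.
exists (And (Neg phi) t) => //; apply/List.in_app_iff; right.
exact: List.in_map.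
Qed.

Lemma complete_types_agree L t vA vB : List.In t (complete_types L) ->
  sat vA t -> sat vB t -> forall phi, List.In phi L -> agree phi vA vB.
Proof.
elim: L t => [//|phi L IH] t /= tL At Bt psi.
case/List.in_app_iff: tL At Bt => /List.in_map_iff[t' [<- t'L]] /= [A1 A2] [B1 B2].
  by case=> [<-//|]; exact: IH t'L A2 B2 psi.
by case=> [<-//|]; exact: IH t'L A2 B2 psi.
Qed.

Definition back_forth x y (Q : _ -> _ -> Prop) vA vB : Prop :=
  (forall a, place vA y a ->
     exists2 b, place vB y b & Q vA.[x <- a] vB.[x <- b]) /\
  (forall b, place vB y b ->
     exists2 a, place vA y a & Q vA.[x <- a] vB.[x <- b]).

(** Spoiler's element realises a complete type [t] over [L]. Its quantification transfers to the
    other structure, and a witness there is Duplicator's answer: it has the same type, so the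
    extended assignments agree on [L]. *)
Lemma forced_back_forth k S x y Q :
  move S x y -> forced k (x |` S) Q -> forced k.+1 S (back_forth x y Q).
Proof.
move=> m [L LC LQ]; exists (map (quant x y) (complete_types L)).
  move=> phi /List.in_map_iff[t [<- /(complete_types_CFO LC)]].
  exact: CFO_quant.
move=> vA vB H.
have {}H t : List.In t (complete_types L) -> agree (quant x y t) vA vB.
  by move=> tL; apply: H; exact: List.in_map.
split=> [a pa|b pb].
  have [t tL At] := complete_types_ex vA.[x <- a] L.
  have [|b pb Bt] := (sat_quant vB t m).1 ((H t tL).1 _).
    by apply/(sat_quant _ _ m); exists a.
  by exists b => //; apply: LQ; exact: complete_types_agree tL At Bt.
have [t tL Bt] := complete_types_ex vB.[x <- b] L.
have [|a pa At] := (sat_quant vA t m).1 ((H t tL).2 _).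
  by apply/(sat_quant _ _ m); exists b.
by exists a => //; apply: LQ; exact: complete_types_agree tL At Bt.
Qed.

Lemma forced_winning S : valid S ->
  forced 0 S (fun vA vB =>
    forall c, domf c = S -> projections c vA vB -> winning c).
Proof.
move=> vS.
(* There are finitely many atoms over [S]. Binary ones are kept only under a membership condition,
   because variables of unrelated clusters may not be compared. *)
have F : forced 0 S (fun vA vB => forall x, x \in S ->
    (forall l, l \in enum 'I_N -> agree (Lab l x) vA vB) /\
    forall z, z \in S ->
      (CFO 0 S (Edge N x z) -> agree (Edge N x z) vA vB) /\
      (CFO 0 S (Cmp N Eq x z) -> agree (Cmp N Eq x z) vA vB) /\
      (CFO 0 S (Cmp N Lt x z) -> agree (Cmp N Lt x z) vA vB) /\
      (CFO 0 S (Cmp N Gt x z) -> agree (Cmp N Gt x z) vA vB)).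
  apply: forced_all => x xS; apply: forced_and.
    by apply: forced_all => l _; apply: forced_agree; exact: CFO_lab.
  apply: forced_all => z zS.
  by do ![apply: forced_and]; apply: forced_cond; exact: forced_agree.
apply: forced_impl F => vA vB H c dc p.
have inS x ab : c.[? x] = Some ab -> x \in S by move=> cx; rewrite -dc; exact: fnd_domf cx.
have cmp x z a b a' b' : (forall r, CFO 0 S (Cmp N r x z)) ->
    c.[? x] = Some (a, b) -> c.[? z] = Some (a', b') ->
    forall r, compare_rel r a a' <-> compare_rel r b b'.
  move=> C cx cz r; apply/(holds2_projections _ _ p cx cz).
  have [_ /(_ _ (inS _ _ cz))[_ [H1 [H2 H3]]]] := H _ (inS _ _ cx).
  by case: (r); [exact: H1|exact: H2|exact: H3].
(* Both orientations are recorded because [CFO_cmp_child] puts the child variable first; the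
   reversed order is read off from [Gt]. *)
have ord x z a b a' b' : (forall r, CFO 0 S (Cmp N r x z)) ->
    c.[? x] = Some (a, b) -> c.[? z] = Some (a', b') ->
    ((a = a' <-> b = b') /\ ((a < a')%O <-> (b < b')%O)) /\
    ((a' = a <-> b' = b) /\ ((a' < a)%O <-> (b' < b)%O)).
  move=> C cx cz; have E := cmp _ _ _ _ _ _ C cx cz.
  have e : a = a' <-> b = b' by split=> /eqP/(E Eq)/eqP.
  split; split; [exact: e|exact: (E Lt)| |exact: (E Gt)].
  by split=> /esym/e/esym.
have ordw w : partial_iso_order (cluster c w).
  move=> a b a' b' [i ci] [j cj].
  have [r|//] := ord _ _ _ _ _ _ _ ci cj.
  by apply: CFO_cmp; [exact: inS ci|exact: inS cj].
split=> [w wS|w e eS].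
  split=> //.
    move=> a b a' b' [i ci] [j cj].
    have [_ /(_ _ (inS _ _ cj))[E _]] := H _ (inS _ _ ci).
    apply/(holds2_projections _ _ p ci cj)/E.
    by apply: CFO_edge; [exact: inS ci|exact: inS cj].
  move=> l a b [i ci]; have [/(_ l (mem_enum _ _)) E _] := H _ (inS _ _ ci).
  by move: E; rewrite /agree /= /holds1 (p _).1 (p _).2 ci.
have chd i r : (w, i) \in S -> CFO 0 S (Cmp N r (rcons w e, 0) (w, i)).
  by move=> iS; apply: CFO_cmp_child => //; rewrite -dc.
move=> a b a' b' [[i ci]|ce] [[j cj]|ce'].
- by apply: (ordw w); [exists i|exists j].
- by apply: (ord _ _ _ _ _ _ _ ce' ci).2 => r; apply: chd; exact: inS ci.
- by apply: (ord _ _ _ _ _ _ _ ce cj).1 => r; apply: chd; exact: inS cj.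
- by move: ce'; rewrite ce => -[-> ->]; rewrite !Order.POrderTheory.ltxx.
Qed.

(** * Forcing a win over the remaining rounds *)

Definition wins_after k x y c : Prop :=
  (forall a, placeA c y a ->
     exists2 b, placeB c y b & wins_from k c.[x <- (a, b)]) /\
  (forall b, placeB c y b ->
     exists2 a, placeA c y a & wins_from k c.[x <- (a, b)]).

Lemma wins_after_other_child k c w e e' :
  valid (domf c) -> (rcons w e, 0) \notin domf c ->
  (rcons w e', 0) \notin domf c ->
  wins_after k (rcons w e, 0) None c -> wins_after k (rcons w e', 0) None c.
Proof.
move=> vc ec e'c [HA HB]; split=> [a|b].
  by case/HA=> b ? W; exists b => //; exact: wins_other_child ec e'c W.
by case/HB=> a ? W; exists a => //; exact: wins_other_child ec e'c W.
Qed.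

(** Turns a property of configurations into one of pairs of assignments, the form that [forced]
    takes. *)
Definition for_config S (P : config Sigma A B -> Prop) vA vB : Prop :=
  forall c, domf c = S -> projections c vA vB -> P c.

Lemma forced_wins_after k S x y : move S x y ->
  forced k (x |` S) (for_config (x |` S) (wins_from k)) ->
  forced k.+1 S (for_config S (wins_after k x y)).
Proof.
move=> m /(forced_back_forth m); apply: forced_impl => vA vB [HA HB] c dc p.
have ext a b : for_config (x |` S) (wins_from k) vA.[x <- a] vB.[x <- b] ->
    wins_from k c.[x <- (a, b)].
  by apply; [rewrite dom_setf dc|exact: projections_set].
split=> [a /(placeAE _ _ p)/HA|b /(placeBE _ _ p)/HB] [g pg /ext W]; exists g => //.
  by apply/(placeBE _ _ p).
by apply/(placeAE _ _ p).
Qed.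

(** One finite list has to meet every move of Spoiler. Root, child and next moves are treated apart,
    the last two reduced to cases indexed by [S]. *)
Lemma forced_wins k S : valid S -> forced k S (for_config S (wins_from k)).
Proof.
elim: k S => [|k IH] S vS; first exact: forced_winning.
have step x y : move S x y -> forced k.+1 S (for_config S (wins_after k x y)).
  by move=> m; apply: (forced_wins_after m); apply: IH; exact: move_valid m.
have root : forced k.+1 S (fun vA vB => S = fset0 ->
    for_config S (wins_after k ([::], 0) None) vA vB).
  by apply: forced_cond => S0; apply: step; exact: move_root.
have child : forced k.+1 S (fun vA vB => forall z, z \in S ->
    forall e, (rcons z.1 e, 0) \notin S ->
    for_config S (wins_after k (rcons z.1 e, 0) None) vA vB).
  apply: forced_all => z /(valid_word0 vS) zS.
  have [[e eS]|none] := EM (exists e, (rcons z.1 e, 0) \notin S); last first.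
    by apply: forced_true => vA vB e eS; case: none; exists e.
  apply: forced_impl (step _ _ (move_child zS eS)) => vA vB H e' e'S c dc p.
  by have := H c dc p; apply: wins_after_other_child; rewrite dc.
have next : forced k.+1 S (fun vA vB => forall z, z \in S ->
    forall i, least_new S z.1 i -> z.2 < i ->
    for_config S (wins_after k (z.1, i) (Some z)) vA vB).
  apply: forced_all => z zS.
  (* The least new index of a cluster is unique, so each anchor [z] gives at most one move. *)
  have [[i [li lt_i]]|none] := EM (exists i, least_new S z.1 i /\ z.2 < i); last first.
    by apply: forced_true => vA vB i li lt_i; case: none; exists i.
  have m : move S (z.1, i) (Some z).
    by case: z zS li lt_i => w j /= zS li; apply: move_next; rewrite ?(valid_word0 vS zS).
  apply: forced_impl (step _ _ m) => vA vB H i' [i'S lt'] _.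
  suff -> : i' = i by [].
  case: li => iS lt; apply/eqP; rewrite eqn_leq; apply/andP; split.
    by rewrite leqNgt; apply: contraNN iS => /lt'.
  by rewrite leqNgt; apply: contraNN i'S => /lt.
apply: forced_impl (forced_and root (forced_and child next)).
move=> vA vB [Hr [Hc Hn]] c dc p x y; rewrite dc.
case=> [S0|w e wS eS|w i j wS li lt_j].
- exact: Hr.
- exact: (Hc (w, 0)).
- by apply: (Hn (w, j)) => //; case: li => _; apply.
Qed.

End Configurations.

Theorem mainTheorem4 (Sigma : choiceType)
    (Sigma_infinite : infinite_set [set: Sigma]%classic)
    (N : nat) (dA dB : Order.disp_t)
    (A : ordGraph N dA) (B : ordGraph N dB) (k : nat) :
  same_CFO_sentences Sigma A B k <-> Duplicator_wins Sigma A B k.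
Proof.
have p0 : projections ([fmap]%fmap : config Sigma A B) [fmap]%fmap [fmap]%fmap.
  by move=> x; rewrite !fnd_fmap0.
split=> [H|W phi C].
  (* Over the empty set the forcing formulas are sentences, so the hypothesis makes the empty
     assignments agree on them. *)
  have [L LC LW] := forced_wins A B k (valid0 Sigma).
  by apply: (LW [fmap]%fmap [fmap]%fmap) => // phi /LC; exact: H.
exact: (wins_agree Sigma_infinite C _ (valid0 Sigma) p0 W).
Qed.
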